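(* Let $\mathcal{T}$ be a unitary quantum walk symmetry on the Cayley graph $\Gamma=\Gamma(G,S)$. Then there are a unique local unitary operation $U_0$ on $\mathcal{H}$ and a unique sequence $(U_n)_{n=1}^{+\infty}$ of local unitary operations on $\mathcal{H}$, each diagonal in the geometrical basis of $\mathcal{H}$, say $U_n=\sum_{x\in G}\sum_{c\in S}u_{n,x,c}\,|x,c\rangle\langle x,c|$ with $|u_{n,x,c}|=1$ for $n\ge 1$, such that for each quantum coin $\mathcal{C}=(C_n)_{n=0}^{+\infty}$ and each initial state $|\psi_0\rangle$, the image $(\tilde{\mathcal{C}},|\tilde\psi_0\rangle)=\mathcal{T}(\mathcal{C},|\psi_0\rangle)$, $\tilde{\mathcal{C}}=(\tilde C_n)_{n=0}^{+\infty}$, satisfies $|\tilde\psi_0\rangle=U_0|\psi_0\rangle$ and $$\forall n\in\mathbb{N}_0:\quad \tilde C_n=\sum_{x\in G}|x\rangle\langle x|\otimes\left(V_{n,x}C_{n,x}U_{n,x}^\dagger\right),$$ where $V_{n,x}\in U(\mathcal{H}_C)$ is related to $U_{n+1}$ by $$V_{n,x}=\sum_{c\in S}u_{n+1,xc,c}\,|c\rangle\langle c|.$$ Conversely, given any local unitary $U_0$ and any sequence $(U_n)_{n=1}^{+\infty}$ of local unitary operations diagonal in the geometrical basis of $\mathcal{H}$, there is a unique unitary quantum walk symmetry $\mathcal{T}$ yielding these values. Therefore, the symmetry group of the quantum walk evolution $|\psi_n\rangle=W_{\mathcal{C}}(n)|\psi_0\rangle$ is $U(\mathcal{H}_C)^G\times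 U(1)^{G\times\mathbb{N}\times S}$.
   Context: $\mathbb{N}=\{1,2,\dots\}$, $\mathbb{N}_0=\mathbb{N}\cup\{0\}$. $G$ is a discrete group generated by a finite set $S$; the Cayley graph $\Gamma=\Gamma(G,S)$ is the directed graph with vertex set $G$ and edge set $\{(g,gs)\mid g\in G,s\in S\}$. $\mathcal{H}_S=\ell^2(G)$ has orthonormal basis $\{|x\rangle\mid x\in G\}$, $\mathcal{H}_C=\ell^2(S)$ has orthonormal basis $\{|c\rangle\mid c\in S\}$, and $\mathcal{H}=\mathcal{H}_S\otimes\mathcal{H}_C$ has orthonormal basis $|x,c\rangle=|x\rangle\otimes|c\rangle$; these are the geometrical bases. $U(\cdot)$ denotes the unitary group of a Hilbert space, and $U(1)$ the group of complex numbers of modulus $1$. An operator $A\in GL(\mathcal{H})$ is a local operation if $A=\sum_{x\in G}|x\rangle\langle x|\otimes A_x$ for some (necessarily unique) operators $A_x\in GL(\mathcal{H}_C)$, its components. For a sequence of local operations $A_n$, the components of $A_n$ are written $A_{n,x}$. The step operator $T$ on $\mathcal{H}$ is the unitary operator with $T|x,c\rangle=|xc,c\rangle$. A quantum coin is a sequence $\mathcal{C}=(C_n)_{n=0}^{+\infty}$ of local unitary operations on $\mathcal{H}$. Put $W_{\mathcal{C}}(n)=TC_{n-1}TC_{n-2}\cdots TC_0$ for $n\in\mathbb{N}_0$ (so $W_{\mathcal C}(0)=\mathrm{Id}$). An initial state is a vector $|\psi_0\rangle\in\mathcal{H}$. A unitary quantum walk symmetry on $\Gamma$ is an endomorphism $\mathcal{T}$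 on the Cartesian product of the set of quantum coins and the set of initial states (a map of this product to itself, $(\mathcal{C},|\psi_0\rangle)\mapsto(\tilde{\mathcal{C}},|\tilde\psi_0\rangle)$) for which there is a sequence of local unitary operators $(U_n)_{n=0}^{+\infty}$ such that for each quantum coin $\mathcal{C}$, each initial state $|\psi_0\rangle$ and all $n\in\mathbb{N}_0$: $W_{\tilde{\mathcal{C}}}(n)|\tilde\psi_0\rangle=U_nW_{\mathcal{C}}(n)|\psi_0\rangle$.
   Formalization: A symmetry is additionally required to give a new coin that depends only on the old coin, not on the initial state; otherwise the claim fails, e.g. for the identity map altered to send (C,0) to (C',0) for one coin C and some C' different from C. *)

(* Defs.v *)
From HB Require Import structures.
From mathcomp Require Import all_boot all_order all_algebra finmap.
From mathcomp Require Import all_classical all_reals ereal esum.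
From mathcomp Require Import complex ring.

Set Implicit Arguments.
Unset Strict Implicit.
Unset Printing Implicit Defensive.

Import Order.TTheory GRing.Theory Num.Theory.
Import ComplexField.Normc.

Local Open Scope classical_set_scope.
Local Open Scope ring_scope.

Definition generates (G : groupType) (S : {fset G}) : Prop :=
  forall P : set G, P 1%g -> (forall x y, P x -> P y -> P (x * y)%g) ->
    (forall x, P x -> P x^-1%g) -> (forall x, x \in S -> P x) -> P = setT.

(* l^2(G) (x) l^2(S) is realized as l^2(G * S): the value of psi at (x, c) is
   the coordinate <x,c|psi>. *)
Section Hilbert_space.
Variables (R : realType) (I : choiceType).

Definition square_summable : {pred I -> R[i]} :=
  fun f => `[< (\esum_(p in [set: I]) (normc (f p) ^+ 2)%:E < +oo)%E >].

Lemma normc_sqrD (x y : R[i]) :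
  normc (x + y) ^+ 2 <= 2 * normc x ^+ 2 + 2 * normc y ^+ 2.
Proof.
have n0 (z : R[i]) : 0 <= normc z by case: z => ? ?; exact: sqrtr_ge0.
have h : normc (x + y) ^+ 2 <= (normc x + normc y) ^+ 2.
  by rewrite ler_sqr ?nnegrE ?addr_ge0// le_normcD.
have k (a b : R) : (a + b) ^+ 2 <= 2 * a ^+ 2 + 2 * b ^+ 2.
  rewrite -subr_ge0 (_ : _ - _ = (a - b) ^+ 2) ?sqr_ge0//; ring.
exact: (le_trans h (k _ _)).
Qed.

Lemma esumZ_lty (c : R) (h : I -> R) : 0 <= c -> (forall p, 0 <= h p) ->
  (\esum_(p in [set: I]) (h p)%:E < +oo)%E ->
  (\esum_(p in [set: I]) (c * h p)%:E < +oo)%E.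
Proof.
move=> c0 h0 hoo.
have s0 : (0 <= \esum_(p in [set: I]) (h p)%:E)%E.
  by apply: esum_ge0 => p _; rewrite lee_fin.
apply: (@le_lt_trans _ _ (c%:E * \esum_(p in [set: I]) (h p)%:E)%E); last first.
  by rewrite lte_mul_pinfty// ?lee_fin// fin_numE -ltNye ltxx.
apply: ge_ereal_sup => _ [A [finA AT] <-].
under eq_fsbigr do rewrite EFinM.
rewrite -ge0_mule_fsumr; last by move=> p; rewrite lee_fin.
apply: lee_wpmul2l; first by rewrite lee_fin.
by apply: esum_ge; exists A.
Qed.

Lemma square_summable_submod : submod_closed square_summable.
Proof.
have n0 (z : R[i]) : 0 <= normc z ^+ 2 by rewrite sqr_ge0.
split.
  by apply/asboolP; rewrite esum1// => p _; rewrite normc0 expr0n.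
move=> a f g /asboolP ff /asboolP gg; apply/asboolP.
apply: (@le_lt_trans _ _ (\esum_(p in [set: I]) ((2 * normc a ^+ 2) *
    normc (f p) ^+ 2)%:E + \esum_(p in [set: I]) (2 * normc (g p) ^+ 2)%:E)%E).
  have m0 (b : R) z : 0 <= b -> 0 <= b * normc (z : R[i]) ^+ 2.
    by move=> b0; exact: mulr_ge0.
  rewrite -esumD; first last.
  - by move=> p _; rewrite lee_fin m0.
  - by move=> p _; rewrite lee_fin !m0.
  apply: le_esum => p _; rewrite -EFinD lee_fin.
  apply: le_trans (normc_sqrD _ _) _.
  by rewrite normcM exprMn mulrA.
by rewrite lte_add_pinfty// esumZ_lty// mulr_ge0.
Qed.

HB.instance Definition _ := GRing.isSubmodClosed.Build R[i] (I -> R[i])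
  square_summable square_summable_submod.

Record l2 := L2 { l2_fun :> I -> R[i]; l2_funP : l2_fun \in square_summable }.

HB.instance Definition _ := [isSub of l2 for l2_fun].
HB.instance Definition _ := [Choice of l2 by <:].
HB.instance Definition _ := [SubChoice_isSubLmodule of l2 by <:].

(* The unconditional sum of h when h is absolutely summable, as is the case for
   the products of two square-summable families used in inner. *)
Definition rsum (h : I -> R) : R :=
  fine (\esum_(p in [set: I]) (Num.max (h p) 0)%:E) -
  fine (\esum_(p in [set: I]) (Num.max (- h p) 0)%:E).

Definition csum (h : I -> R[i]) : R[i] :=
  Complex (rsum (fun p => complex.Re (h p))) (rsum (fun p => complex.Im (h p))).

Definition inner (f g : l2) : R[i] := csum (fun p => (f p)^* * g p).

(* A linear surjection preserving the inner product is bijective. *)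
Definition unitary (A : l2 -> l2) : Prop :=
  [/\ linear A, (forall g, exists f, A f = g) &
      forall f g, inner (A f) (A g) = inner f g].

Definition delta (p q : I) : R[i] := (q == p)%:R.

Lemma square_summable_delta p : delta p \in square_summable.
Proof.
apply/asboolP.
rewrite (_ : esum _ _ = \esum_(q in [set p]) (normc (delta p q) ^+ 2)%:E).
  by rewrite esum_set1 ?lee_fin ?sqr_ge0// ltry.
rewrite [RHS]esum_mkcond; apply: eq_esum => q _.
case: ifPn => //; rewrite in_set1 /delta => /negbTE ->.
by rewrite normc0 expr0n.
Qed.

Definition basis_vector p : l2 := L2 (square_summable_delta p).

End Hilbert_space.

Section unitary_groups.
Variables (R : realType) (n : nat).

Definition adjoint (A : 'M[R[i]]_n) : 'M[R[i]]_n := map_mx Num.conj A^T.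

Record unitary_group := UnitaryGroup
  { ugval :> 'M[R[i]]_n; ugvalP : ugval \is unitarymx }.

HB.instance Definition _ := [isSub of unitary_group for ugval].
HB.instance Definition _ := [Choice of unitary_group by <:].

Lemma ug_one_subproof : (1%:M : 'M[R[i]]_n) \is unitarymx.
Proof. by apply/unitarymxP; rewrite mul1mx trmx1 map_mx1. Qed.

Lemma ug_inv_subproof (A : unitary_group) : adjoint A \is unitarymx.
Proof. by rewrite trmxC_unitary ugvalP. Qed.

Definition ug_one := UnitaryGroup ug_one_subproof.
Definition ug_inv A := UnitaryGroup (ug_inv_subproof A).
Definition ug_mul (A B : unitary_group) :=
  UnitaryGroup (mul_unitarymx (ugvalP A) (ugvalP B)).

Lemma ug_mulA : associative ug_mul.
Proof. by move=> A B C; apply: val_inj; rewrite /= mulmxA. Qed.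
Lemma ug_mul1 : left_id ug_one ug_mul.
Proof. by move=> A; apply: val_inj; rewrite /= mul1mx. Qed.
Lemma ug_mulr1 : right_id ug_one ug_mul.
Proof. by move=> A; apply: val_inj; rewrite /= mulmx1. Qed.
Lemma ug_mulV : left_inverse ug_one ug_inv ug_mul.
Proof.
move=> A; apply: val_inj => /=; rewrite /adjoint -invmx_unitary ?ugvalP//.
by rewrite mulVmx// unitarymx_unit// ugvalP.
Qed.
Lemma ug_mulrV : right_inverse ug_one ug_inv ug_mul.
Proof. by move=> A; apply: val_inj => /=; exact/unitarymxP/ugvalP. Qed.

HB.instance Definition _ := isGroup.Build unitary_group
  ug_mulA ug_mul1 ug_mulr1 ug_mulV ug_mulrV.

Record circle := Circle { circle_val :> R[i]; circle_valP : `|circle_val| == 1 }.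

HB.instance Definition _ := [isSub of circle for circle_val].
HB.instance Definition _ := [Choice of circle by <:].

Lemma circle_one_subproof : `|1 : R[i]| == 1.
Proof. by rewrite normr1. Qed.
Lemma circle_inv_subproof (z : circle) : `|(z : R[i])^-1| == 1.
Proof. by rewrite normfV (eqP (circle_valP z)) invr1. Qed.
Lemma circle_mul_subproof (z w : circle) : `|(z : R[i]) * w| == 1.
Proof. by rewrite normrM (eqP (circle_valP z)) (eqP (circle_valP w)) mulr1. Qed.

Definition circle_one := Circle circle_one_subproof.
Definition circle_inv z := Circle (circle_inv_subproof z).
Definition circle_mul z w := Circle (circle_mul_subproof z w).

Lemma circle_mulA : associative circle_mul.
Proof. by move=> x y z; apply: val_inj; rewrite /= mulrA. Qed.
Lemma circle_mul1 : left_id circle_one circle_mul.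
Proof. by move=> x; apply: val_inj; rewrite /= mul1r. Qed.
Lemma circle_mulr1 : right_id circle_one circle_mul.
Proof. by move=> x; apply: val_inj; rewrite /= mulr1. Qed.
Lemma circle_neq0 (z : circle) : (z : R[i]) != 0.
Proof. by rewrite -normr_eq0 (eqP (circle_valP z)) oner_neq0. Qed.
Lemma circle_mulV : left_inverse circle_one circle_inv circle_mul.
Proof. by move=> x; apply: val_inj; rewrite /= mulVf ?circle_neq0. Qed.
Lemma circle_mulrV : right_inverse circle_one circle_inv circle_mul.
Proof. by move=> x; apply: val_inj; rewrite /= mulfV ?circle_neq0. Qed.

HB.instance Definition _ := isGroup.Build circle
  circle_mulA circle_mul1 circle_mulr1 circle_mulV circle_mulrV.

End unitary_groups.

Section group_power.
Variables (T : Type) (K : groupType).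
Implicit Types f g : T -> K.

Let one : T -> K := fun=> 1%g.
Let inv f : T -> K := fun t => (f t)^-1%g.
Let mul f g : T -> K := fun t => (f t * g t)%g.
Let mulA : associative mul.
Proof. by move=> f g h; apply/funext => t; exact: mulgA. Qed.
Let mul1 : left_id one mul.
Proof. by move=> f; apply/funext => t; exact: mul1g. Qed.
Let mulr1 : right_id one mul.
Proof. by move=> f; apply/funext => t; exact: mulg1. Qed.
Let mulV : left_inverse one inv mul.
Proof. by move=> f; apply/funext => t; exact: mulVg. Qed.
Let mulrV : right_inverse one inv mul.
Proof. by move=> f; apply/funext => t; exact: mulgV. Qed.

HB.instance Definition _ := isGroup.Build (T -> K) mulA mul1 mulr1 mulV mulrV.

End group_power.

Definition transformation_group (X : Type) (P : set (X -> X)) : Prop :=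
  [/\ P id, (forall f g, P f -> P g -> P (f \o g)) &
      forall f, P f -> exists g, [/\ P g, cancel f g & cancel g f]].

Section quantum_walks.
Variables (R : realType) (G : groupType) (S : {fset G}).

Local Notation H := (l2 R (G * S)%type).

(* Operators on l^2(S) in the basis (|c>)_(c in S), indexed by enum_rank c. *)
Local Notation coin_mx := 'M[R[i]]_#|{: S}|.

Definition ket (x : G) (c : S) : H := basis_vector R (x, c).

(* A = \sum_x |x><x| (x) a x *)
Definition decomposition (a : G -> coin_mx) (A : H -> H) : Prop :=
  forall psi x (c : S), A psi (x, c) =
    \sum_(d : S) a x (enum_rank c) (enum_rank d) * psi (x, d).

(* A unitary operator is in GL(H), so only the decomposition is required. *)
Definition local_unitary (A : H -> H) : Prop :=
  unitary A /\
  exists a, (forall x, a x \in unitmx) /\ decomposition a A.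

(* The matrix with entries <x,c|A|x,d>: for a local A this is A_x, by
   componentE below. *)
Definition component (A : H -> H) (x : G) : coin_mx :=
  \matrix_(i, j) A (ket x (enum_val j)) (x, enum_val i).

Lemma componentE a A : decomposition a A -> component A = a.
Proof.
move=> Aa; apply/funext => x; apply/matrixP => i j; rewrite mxE Aa.
rewrite (bigD1 (enum_val j)) //= big1 ?addr0; last first.
  move=> d dj; rewrite /delta xpair_eqE eqxx /= (negbTE dj).
  by rewrite mulr0.
by rewrite /delta eqxx mulr1 !enum_valK.
Qed.

(* A = \sum_(x, c) u x c |x,c><x,c| *)
Definition diagonal (u : G -> S -> R[i]) (A : H -> H) : Prop :=
  forall psi x (c : S), A psi (x, c) = u x c * psi (x, c).

Definition step_fun (psi : H) : G * S -> R[i] :=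
  fun p => psi ((p.1 * (val p.2)^-1)%g, p.2).

Lemma step_funP psi : step_fun psi \in square_summable (I := (G * S)%type).
Proof.
apply/asboolP; have /asboolP := l2_funP psi.
rewrite (@reindex_esum _ _ _ setT setT
  (fun p : G * S => ((p.1 * (val p.2)^-1)%g, p.2)))//.
split=> [p _ //|[x c] [y d] _ _ /= [+ cd]|[x c] _].
  by rewrite cd => /mulIg ->.
by exists ((x * val c)%g, c) => //=; rewrite mulgK.
Qed.

Definition step (psi : H) : H := L2 (step_funP psi).

Lemma step_ket x (c : S) : step (ket x c) = ket (x * val c)%g c.
Proof.
apply/val_inj/funext => -[y d]; rewrite /= /step_fun /delta /=.
rewrite !xpair_eqE; case: (eqVneq d c) => [->|_]; last by rewrite !andbF.
by rewrite !andbT -(inj_eq (mulIg (val c))) mulgVK.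
Qed.

Record quantum_coin := QuantumCoin {
  coin_op :> nat -> H -> H;
  coin_opP : forall n, local_unitary (coin_op n) }.

Fixpoint evolution (C : quantum_coin) (n : nat) : H -> H :=
  if n is m.+1 then step \o C m \o evolution C m else id.

Definition walk_map := quantum_coin * H -> quantum_coin * H.

(* The first clause says that the new coin depends on the coin only, as befits
   an endomorphism of a product: for psi0 = 0, or psi0 of finite support, the
   equations of the second clause do not determine the new coin. *)
Definition unitary_symmetry (T : walk_map) : Prop :=
  (forall C psi psi', (T (C, psi)).1 = (T (C, psi')).1) /\
  exists U : nat -> H -> H, (forall n, local_unitary (U n)) /\
    forall (C : quantum_coin) psi n,
      evolution (T (C, psi)).1 n (T (C, psi)).2 = U n (evolution C n psi).

(* U_0 is an arbitrary local unitary, and U_n is diagonal for n >= 1. *)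
Definition symmetry_parameters (U : nat -> H -> H) : Prop :=
  (forall n, local_unitary (U n)) /\
  forall n, (0 < n)%N ->
    exists u, (forall x c, `|u x c| = 1) /\ diagonal u (U n).

(* <x,c|A|x,c>: the coefficient u x c of a diagonal operator A. *)
Definition diagonal_coef (A : H -> H) (x : G) (c : S) : R[i] :=
  A (ket x c) (x, c).

(* V_(n,x) = \sum_c u_(n+1,xc,c) |c><c| *)
Definition coin_factor (U : nat -> H -> H) (n : nat) (x : G) : coin_mx :=
  diag_mx (\row_i
    let c : S := enum_val i in diagonal_coef (U n.+1) (x * val c)%g c).

Definition symmetry_formula (T : walk_map) (U : nat -> H -> H) : Prop :=
  [/\ forall C psi, (T (C, psi)).2 = U 0%N psi,
      forall n x, coin_factor U n x \is unitarymx &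
      forall (C : quantum_coin) psi n,
        decomposition (fun x => coin_factor U n x *m component (C n) x
                                *m adjoint (component (U n) x))
          ((T (C, psi)).1 n)].

Definition positive_nat := {n : nat | (0 < n)%N}.

(* U(l^2(S))^G x U(1)^(G x N x S), with N = {1, 2, ...} *)
Definition parameter_group : groupType :=
  ((G -> unitary_group R #|{: S}|) *
   (G * positive_nat * S -> circle R))%type.

Definition parameter_values (k : parameter_group) (U : nat -> H -> H) : Prop :=
  decomposition (fun x => k.1 x) (U 0%N) /\
  forall n : positive_nat, diagonal (fun x c => k.2 (x, n, c)) (U (val n)).

End quantum_walks.

(* Main.v *)
(* Since a symmetry commutes with the evolution and evolutions are onto, the new
   coin D satisfies T D_n U_n = U_(n+1) T C_n, where T is the step.  For C_n = 1
   this says that T^-1 U_(n+1) T = D_n U_n is a local operation; as T moves the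
   coin states over one vertex to distinct vertices, U_(n+1) must be diagonal.
   For a diagonal U_(n+1) the operator T^-1 U_(n+1) T has components V_(n,x), and
   the relation amounts to D_(n,x) = V_(n,x) C_(n,x) U_(n,x)^*.  Conversely this
   formula defines a symmetry, and it is compatible with composition.
   Operators are handled through fibers, the restrictions of psi to {x} * S: a
   local operation multiplies the fiber over x by its component at x. *)
From mathcomp Require Import all_boot all_order all_algebra finmap.
From mathcomp Require Import all_classical all_reals ereal esum complex.
From mathcomp Require Import lra.
Require Import Defs.

Set Implicit Arguments.
Unset Strict Implicit.
Unset Printing Implicit Defensive.

Import Order.TTheory GRing.Theory Num.Theory.
Import ComplexField.Normc.

Local Open Scope classical_set_scope.
Local Open Scope ring_scope.
Local Open Scope sesquilinear_scope.

(** * Unconditional sums of real families *)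

Section rsum.
Variable R : realType.

Lemma esum_EFin_ge0 (I : choiceType) (h : I -> R) : (forall p, 0 <= h p) ->
  (0 <= \esum_(p in [set: I]) (h p)%:E)%E.
Proof. by move=> h0; apply: esum_ge0 => p _; rewrite lee_fin. Qed.

Lemma esum_le_lty (I : choiceType) (h b : I -> R) : (forall p, h p <= b p) ->
  (\esum_(p in [set: I]) (b p)%:E < +oo)%E ->
  (\esum_(p in [set: I]) (h p)%:E < +oo)%E.
Proof.
by move=> hb; apply: le_lt_trans; apply: le_esum => p _; rewrite lee_fin.
Qed.

Lemma esum_fin_num (I : choiceType) (h : I -> R) : (forall p, 0 <= h p) ->
  (\esum_(p in [set: I]) (h p)%:E < +oo)%E ->
  (\esum_(p in [set: I]) (h p)%:E)%E \is a fin_num.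
Proof. by move=> h0 hoo; rewrite ge0_fin_numE// esum_EFin_ge0. Qed.

(** The positive part [P] and the negative part [N] of [u - v] satisfy [P + v = N + u] pointwise.
    All four sums are finite, so this identity can be summed and rearranged. *)
Lemma rsumB (I : choiceType) (u v : I -> R) :
  (forall p, 0 <= u p) -> (forall p, 0 <= v p) ->
  (\esum_(p in [set: I]) (u p)%:E < +oo)%E ->
  (\esum_(p in [set: I]) (v p)%:E < +oo)%E ->
  rsum (fun p => u p - v p) = fine (\esum_(p in [set: I]) (u p)%:E) -
                              fine (\esum_(p in [set: I]) (v p)%:E).
Proof.
move=> u0 v0 uoo voo.
pose P p := Num.max (u p - v p) 0; pose N p := Num.max (- (u p - v p)) 0.
have P0 p : 0 <= P p by rewrite /P le_max lexx orbT.
have N0 p : 0 <= N p by rewrite /N le_max lexx orbT.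
have Pu p : P p <= u p by rewrite /P ge_max u0 andbT gerBl.
have Nv p : N p <= v p by rewrite /N ge_max v0 andbT opprB gerBl.
have Poo := esum_le_lty Pu uoo; have Noo := esum_le_lty Nv voo.
have e : (\esum_(p in [set: I]) (P p)%:E + \esum_(p in [set: I]) (v p)%:E =
          \esum_(p in [set: I]) (N p)%:E + \esum_(p in [set: I]) (u p)%:E)%E.
  rewrite -!esumD; try by move=> p _; rewrite lee_fin.
  apply: eq_esum => p _; rewrite -!EFinD; congr _%:E.
  rewrite /P /N; have [h|h] := leP 0 (u p - v p).
  - by rewrite max_r ?oppr_le0// add0r subrK.
  - by rewrite max_l ?oppr_ge0 1?ltW// opprB subrK add0r.
move: e; rewrite -/P -/N -(fineK (esum_fin_num P0 Poo)).
rewrite -(fineK (esum_fin_num N0 Noo)) -(fineK (esum_fin_num u0 uoo)).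
rewrite -(fineK (esum_fin_num v0 voo)).
rewrite -!EFinD => -[e]; rewrite /rsum -/P -/N !fineK ?esum_fin_num//=.
lra.
Qed.

Lemma esum_prod (I : choiceType) (J : finType) (h : I * J -> R) :
  (forall p, 0 <= h p) ->
  (\esum_(p in [set: I * J]) (h p)%:E =
   \esum_(x in [set: I]) (\sum_(c : J) h (x, c))%:E)%E.
Proof.
move=> h0.
rewrite (_ : [set: I * J] = [set: I] `*`` (fun=> [set: J])); last first.
  by apply/seteqP; split.
under eq_esum do rewrite [X in h X]surjective_pairing.
rewrite -(@esum_esum _ _ _ _ _ (fun x c => (h (x, c))%:E)); last first.
  by move=> x c _ _; rewrite lee_fin.
apply: eq_esum => x _; rewrite esum_fset; last 2 first.
- exact: finite_finset.
- by move=> c _; rewrite lee_fin.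
rewrite -sumEFin fsbig_finite//=.
rewrite (perm_big (index_enum J)) //=.
apply: uniq_perm; rewrite ?index_enum_uniq ?fset_uniq // => c.
rewrite mem_index_enum in_fset_set; first by rewrite in_setT.
exact: finite_finset.
Qed.

(** Tonelli applies to the positive and the negative part of [h] separately. Summed over [J], these
    need not be the positive and negative parts of the sum of [h]; this is why [rsumB] admits
    arbitrary nonnegative [u] and [v]. *)
Lemma rsum_prod (I : choiceType) (J : finType) (h b : I * J -> R) :
  (forall p, `|h p| <= b p) -> (\esum_(p in [set: I * J]) (b p)%:E < +oo)%E ->
  rsum h = rsum (fun x => \sum_(c : J) h (x, c)).
Proof.
move=> hb boo.
pose P p := Num.max (h p) 0; pose N p := Num.max (- h p) 0.
have P0 p : 0 <= P p by rewrite /P le_max lexx orbT.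
have N0 p : 0 <= N p by rewrite /N le_max lexx orbT.
have Pb p : P p <= b p.
  by apply: le_trans (hb p); rewrite /P ge_max ler_norm normr_ge0.
have Nb p : N p <= b p.
  by apply: le_trans (hb p); rewrite /N ge_max ler_normr lexx orbT normr_ge0.
have Poo := esum_le_lty Pb boo; have Noo := esum_le_lty Nb boo.
rewrite (_ : (fun x => _) =
    (fun x => \sum_(c : J) P (x, c) - \sum_(c : J) N (x, c))); last first.
  apply/funext => x; rewrite -sumrB; apply: eq_bigr => c _.
  rewrite /P /N; have [h0|h0] := leP 0 (h (x, c)).
  - by rewrite max_r ?oppr_le0// subr0.
  - by rewrite max_l ?oppr_ge0 1?ltW// opprK add0r.
rewrite rsumB; first by rewrite -!esum_prod.
- by move=> x; apply: sumr_ge0.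
- by move=> x; apply: sumr_ge0.
- by rewrite -esum_prod.
- by rewrite -esum_prod.
Qed.

Lemma rsum_point (I : choiceType) (x : I) (h : I -> R) :
  (forall y, y != x -> h y = 0) -> rsum h = h x.
Proof.
move=> hx.
have k (g : I -> R) : (forall y, 0 <= g y) -> (forall y, y != x -> g y = 0) ->
    fine (\esum_(y in [set: I]) (g y)%:E) = g x.
  move=> g0 gx.
  rewrite (_ : esum _ _ = \esum_(y in [set x]) (g y)%:E).
    by rewrite esum_set1 ?lee_fin.
  rewrite [RHS]esum_mkcond; apply: eq_esum => y _.
  by case: ifPn => //; rewrite in_set1 => yx; rewrite gx.
rewrite /rsum !k.
- have [h0|h0] := leP 0 (h x).
  + by rewrite max_r ?oppr_le0// subr0.
  + by rewrite max_l ?oppr_ge0 1?ltW// opprK add0r.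
- by move=> y; rewrite le_max lexx orbT.
- by move=> y /hx ->; rewrite oppr0 maxxx.
- by move=> y; rewrite le_max lexx orbT.
- by move=> y /hx ->; rewrite maxxx.
Qed.

End rsum.

(** * Fibers over vertices and operators acting fiberwise *)

Section fibers.
Variables (R : realType) (I : choiceType) (J : finType).
Local Notation C := R[i].
Local Notation n := #|J|.
Local Notation H := (l2 R (I * J)%type).
Implicit Types (f g : I * J -> C) (u w : 'cV[C]_n).

Definition fiber f (x : I) : 'cV[C]_n := \col_i f (x, enum_val i).

Definition unfiber (v : I -> 'cV[C]_n) : I * J -> C :=
  fun p => v p.1 (enum_rank p.2) 0.

Lemma fiberK v x : fiber (unfiber v) x = v x.
Proof. by apply/colP => i; rewrite mxE /unfiber /= enum_valK. Qed.

Lemma fiberE f x c : f (x, c) = fiber f x (enum_rank c) 0.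
Proof. by rewrite mxE enum_rankK. Qed.

Lemma fiber_inj f g : (forall x, fiber f x = fiber g x) -> f = g.
Proof. by move=> fg; apply/funext => -[x c]; rewrite !fiberE fg. Qed.

Lemma l2_fiber_inj (f g : H) : (forall x, fiber f x = fiber g x) -> f = g.
Proof. by move=> fg; apply/val_inj/fiber_inj. Qed.

Definition dot (u w : 'cV[C]_n) : C := (u^t* *m w) 0 0.

Lemma dotE u w :
  dot u w = \sum_(c : J) (u (enum_rank c) 0)^* * w (enum_rank c) 0.
Proof.
rewrite /dot mxE (reindex_onto enum_rank enum_val) => [|i _]; last exact: enum_valK.
by apply: eq_big => [c|c _]; rewrite ?enum_rankK ?eqxx// !mxE.
Qed.

Lemma dot_fiber f g x :
  dot (fiber f x) (fiber g x) = \sum_(c : J) (f (x, c))^* * g (x, c).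
Proof. by rewrite dotE; apply: eq_bigr => c _; rewrite -!fiberE. Qed.

Lemma unitarymx_adjoint (a : 'M[C]_n) : a \is unitarymx -> a^t* *m a = 1%:M.
Proof. by move=> au; rewrite -invmx_unitary// mulVmx// unitarymx_unit. Qed.

Lemma dot_unitary (a : 'M[C]_n) u w : a \is unitarymx ->
  dot (a *m u) (a *m w) = dot u w.
Proof.
move=> au; rewrite /dot trmx_mul map_mxM -mulmxA (mulmxA _ a).
by rewrite unitarymx_adjoint// mul1mx.
Qed.

Lemma conjC_mul_normc (z : C) : z^* * z = (normc z ^+ 2)%:C%C.
Proof.
by rewrite mulrC -normCK (_ : `|z| = (normc z)%:C%C)// rmorphXn.
Qed.

Lemma dot_normc f x :
  dot (fiber f x) (fiber f x) = (\sum_(c : J) normc (f (x, c)) ^+ 2)%:C%C.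
Proof.
rewrite dot_fiber rmorph_sum /=; apply: eq_bigr => c _.
by rewrite conjC_mul_normc.
Qed.

(** Summing over [J] first, square-summability involves only the norms of the fibers. Hence
    multiplying fibers by unitary matrices stays inside [l2]. *)
Lemma square_summable_dot f g :
  (forall x, dot (fiber f x) (fiber f x) = dot (fiber g x) (fiber g x)) ->
  f \in @square_summable R _ -> g \in @square_summable R _.
Proof.
move=> fg /asboolP ff; apply/asboolP; move: ff.
rewrite !esum_prod; try by move=> p; exact: sqr_ge0.
suff -> : (fun x => (\sum_c normc (f (x, c)) ^+ 2)%:E) =
  (fun x => (\sum_c normc (g (x, c)) ^+ 2)%:E) by [].
by apply/funext => x; have := fg x; rewrite !dot_normc => -[->].
Qed.

Lemma normc_Re_le (z : C) : `|complex.Re z| <= normc z.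
Proof.
case: z => a b /=; rewrite -sqrtr_sqr ler_sqrt ?lerDl ?sqr_ge0//.
by rewrite addr_ge0 ?sqr_ge0.
Qed.

Lemma normc_Im_le (z : C) : `|complex.Im z| <= normc z.
Proof.
case: z => a b /=; rewrite -sqrtr_sqr ler_sqrt ?lerDr ?sqr_ge0//.
by rewrite addr_ge0 ?sqr_ge0.
Qed.

Lemma normc_ge0 (z : C) : 0 <= normc z.
Proof. by case: z => a b; exact: sqrtr_ge0. Qed.

Lemma normc_conj (z : C) : normc z^* = normc z.
Proof. by case: z => a b /=; rewrite sqrrN. Qed.

(* AM-GM gives the summable bound |f|^2 + |g|^2 on conj(f) g. *)
Lemma inner_fiber (f g : H) :
  inner f g = csum (fun x => dot (fiber f x) (fiber g x)).
Proof.
pose b p := normc (f p) ^+ 2 + normc (g p) ^+ 2.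
have fgb p : normc ((f p)^* * g p) <= b p.
  rewrite normcM normc_conj /b; have := normc_ge0 (f p); have := normc_ge0 (g p).
  nra.
have boo : (\esum_(p in [set: I * J]) (b p)%:E < +oo)%E.
  under eq_esum do rewrite EFinD.
  rewrite esumD; try by move=> p _; rewrite lee_fin sqr_ge0.
  have /asboolP foo := l2_funP f; have /asboolP goo := l2_funP g.
  exact: lte_add_pinfty.
rewrite /inner /csum; congr Complex.
- rewrite (rsum_prod (b := b))//; last first.
    by move=> p; apply: le_trans (fgb p); exact: normc_Re_le.
  by congr rsum; apply/funext => x; rewrite dot_fiber raddf_sum.
- rewrite (rsum_prod (b := b))//; last first.
    by move=> p; apply: le_trans (fgb p); exact: normc_Im_le.
  by congr rsum; apply/funext => x; rewrite dot_fiber raddf_sum.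
Qed.

Lemma csum_point (x : I) (h : I -> C) :
  (forall y, y != x -> h y = 0) -> csum h = h x.
Proof.
move=> hx; rewrite /csum !(rsum_point (x := x)); first by case: (h x).
- by move=> y /hx ->.
- by move=> y /hx ->.
Qed.

Section local_operator.
Variable a : I -> 'M[C]_n.
Hypothesis au : forall x, a x \is unitarymx.

Definition local_fun f : I * J -> C := unfiber (fun x => a x *m fiber f x).

Lemma local_funP (f : H) : local_fun f \in @square_summable R _.
Proof.
apply: square_summable_dot (l2_funP f) => x.
by rewrite fiberK dot_unitary.
Qed.

Definition local_op (f : H) : H := L2 (local_funP f).

Lemma fiber_local_op (f : H) x : fiber (local_op f) x = a x *m fiber f x.
Proof. exact: fiberK. Qed.

End local_operator.

Lemma fiber_linear (f g : H) z x :
  fiber (z *: f + g) x = z *: fiber f x + fiber g x.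
Proof. by apply/colP => i; rewrite !mxE. Qed.

Lemma unitary_local_op a (au : forall x, a x \is unitarymx) :
  unitary (local_op au).
Proof.
split.
- move=> z f g; apply: l2_fiber_inj => x.
  by rewrite fiber_linear !fiber_local_op fiber_linear mulmxDr scalemxAr.
(* The conjugate transposes are again unitary, and their fiberwise action supplies preimages. *)
- have au' x : (a x)^t* \is unitarymx by rewrite trmxC_unitary.
  move=> g; exists (local_op au' g); apply: l2_fiber_inj => x.
  by rewrite !fiber_local_op mulmxA (unitarymxP (au x)) mul1mx.
- move=> f g; rewrite !inner_fiber; congr csum; apply/funext => x.
  by rewrite !fiber_local_op dot_unitary.
Qed.

Lemma fiber_basis_vector x (c : J) y :
  fiber (basis_vector R (x, c)) y = (y == x)%:R *: delta_mx (enum_rank c) 0.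
Proof.
apply/colP => i; rewrite !mxE /= /delta xpair_eqE andbT.
rewrite -(inj_eq enum_rank_inj) enum_valK.
by case: (y == x); rewrite ?mul1r ?mul0r.
Qed.

(** The inner products of the images of the basis vectors over [x] are the entries of
    [(a x)^t* *m a x], so preservation of inner products makes this matrix the identity. *)
Lemma unitary_components (A : H -> H) a :
  unitary A -> (forall (f : H) x, fiber (A f) x = a x *m fiber f x) ->
  forall x, a x \is unitarymx.
Proof.
move=> [_ _ Ainner] Aa x; rewrite -trmxC_unitary; apply/unitarymxP.
(* Inner products yield [a^* a = 1] while [unitarymx] asks for [a a^* = 1], so the conjugate
   transpose is the matrix shown to be unitary. *)
rewrite trmxCK; apply/matrixP => i j.
have := Ainner (basis_vector R (x, enum_val i)) (basis_vector R (x, enum_val j)).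
(* Basis vectors over [x] and their images have zero fibers elsewhere, so both inner products
   collapse to the term at [x]. *)
rewrite !inner_fiber !(csum_point (x := x)) /=; first last.
- move=> y /negbTE yx.
  by rewrite !Aa !fiber_basis_vector yx !scale0r mulmx0 /dot mulmx0 mxE.
- move=> y /negbTE yx.
  by rewrite !fiber_basis_vector yx !scale0r /dot mulmx0 mxE.
rewrite !Aa !fiber_basis_vector eqxx !scale1r !enum_valK.
rewrite /dot trmx_mul map_mxM -mulmxA (mulmxA _ (a x)).
have dmx (M : 'M[C]_n) :
    ((delta_mx i 0 : 'cV_n)^t* *m (M *m (delta_mx j 0 : 'cV_n))) 0 0 = M i j.
  rewrite trmx_delta map_delta_mx -rowE -colE.
  by rewrite !mxE.
rewrite dmx => ->.
by have := dmx 1%:M; rewrite mul1mx.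
Qed.

End fibers.

(** * Local unitaries, coins and surjectivity of the evolution *)

Section quantum_walks.
Variables (R : realType) (G : groupType) (S : {fset G}).
Local Notation C := R[i].
Local Notation H := (l2 R (G * S)%type).
Local Notation n_ := #|{: S}|.
Local Notation coin_mx := 'M[C]_#|{: S}|.
Implicit Types (A B : H -> H) (psi phi : H) (a : G -> coin_mx).
Implicit Types (K : quantum_coin R S) (U : nat -> H -> H).

Lemma decompositionP a A :
  decomposition a A <-> forall psi x, fiber (A psi) x = a x *m fiber psi x.
Proof.
have e psi x i : (a x *m fiber psi x) i 0 =
    \sum_(d : S) a x i (enum_rank d) * psi (x, d).
  rewrite mxE (reindex_onto enum_rank enum_val) => [|j _]; last exact: enum_valK.
  by apply: eq_big => [c|c _]; rewrite ?enum_rankK ?eqxx// -fiberE.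
split=> [aA psi x|aA psi x c].
- by apply/colP => i; rewrite e mxE aA enum_valK.
- by rewrite fiberE aA e.
Qed.

Lemma fiber_local A psi x : local_unitary A ->
  fiber (A psi) x = component A x *m fiber psi x.
Proof.
move=> [_ [a [_ aA]]]; rewrite (componentE aA).
exact: (decompositionP a A).1.
Qed.

Lemma component_unitary A x : local_unitary A -> component A x \is unitarymx.
Proof.
move=> Al; have [uA _] := Al.
exact: (unitary_components uA (fun psi y => fiber_local psi y Al)).
Qed.

Lemma local_unitary_surj A psi : local_unitary A -> exists phi, A phi = psi.
Proof. by move=> [[_ + _] _]; exact. Qed.

Lemma local_unitary_local_op a (au : forall x, a x \is unitarymx) :
  local_unitary (local_op au).
Proof.
split; first exact: unitary_local_op.
exists a; split=> [x|]; first exact: unitarymx_unit.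
by apply/decompositionP => psi x; exact: fiber_local_op.
Qed.

Lemma decomposition_inj a A B : decomposition a A -> decomposition a B -> A = B.
Proof.
move=> /decompositionP aA /decompositionP aB; apply/funext => psi.
by apply: l2_fiber_inj => x; rewrite aA aB.
Qed.

Lemma quantum_coin_inj K K' : (forall n, K n = K' n) -> K = K'.
Proof.
case: K K' => [k kP] [k' k'P] /= e; have {}e : k = k' by apply/funext.
by case: _ / e k'P => k'P; congr QuantumCoin; exact: Prop_irrelevance.
Qed.

Lemma step_surj psi : exists phi, step phi = psi.
Proof.
have sP : (fun p : G * S => psi ((p.1 * val p.2)%g, p.2)) \in @square_summable R _.
  apply/asboolP; have /asboolP := l2_funP psi.
  rewrite (@reindex_esum _ _ _ setT setT
    (fun p : G * S => ((p.1 * val p.2)%g, p.2)))//.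
  split=> [p _ //|[x c] [y d] _ _ /= [+ cd]|[x c] _].
    by rewrite cd => /mulIg ->.
  by exists ((x * (val c)^-1)%g, c) => //=; rewrite mulgVK.
exists (L2 sP); apply/val_inj/funext => -[x c].
by rewrite /= /step_fun /= mulgVK.
Qed.

(** Serves to extend relations known on evolved states to all vectors. *)
Lemma evolution_surj K n psi : exists phi, evolution K n phi = psi.
Proof.
elim: n psi => [psi|n IH psi]; first by exists psi.
have [p1 <-] := step_surj psi.
have [p2 <-] := local_unitary_surj p1 (coin_opP K n).
by have [p3 <-] := IH p2; exists p3.
Qed.

(** * Diagonal operators *)

Definition diag_components (u : G -> S -> C) (x : G) : coin_mx :=
  diag_mx (\row_i u x (enum_val i)).

Lemma diagonalP u A : diagonal u A <-> decomposition (diag_components u) A.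
Proof.
rewrite decompositionP; split=> [uA psi x|uA psi x c].
- by apply/colP => i; rewrite mul_diag_mx !mxE uA.
- by rewrite fiberE uA mul_diag_mx !mxE !enum_rankK.
Qed.

Lemma diag_mx_unitary m (d : 'rV[C]_m) :
  (diag_mx d \is unitarymx) <-> forall i, `|d 0 i| = 1.
Proof.
have e : diag_mx d *m (diag_mx d)^t* = diag_mx (\row_i `|d 0 i| ^+ 2).
  rewrite tr_diag_mx map_diag_mx mulmx_diag; congr diag_mx.
  by apply/rowP => i; rewrite !mxE normCK.
split=> [/unitarymxP|d1].
- rewrite e => /matrixP dI i; have := dI i i.
  rewrite !mxE eqxx mulr1n => /eqP.
  by rewrite sqrp_eq1// => /eqP.
- apply/unitarymxP; rewrite e -diag_const_mx; congr diag_mx.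
  by apply/rowP => i; rewrite !mxE d1 expr1n.
Qed.

Lemma diag_components_unitary u : (forall x c, `|u x c| = 1) ->
  forall x, diag_components u x \is unitarymx.
Proof. by move=> u1 x; apply/diag_mx_unitary => i; rewrite mxE. Qed.

Lemma diagonal_coefE u A : diagonal u A -> diagonal_coef A = u.
Proof.
move=> uA; apply/funext => x; apply/funext => c.
by rewrite /diagonal_coef uA /= /delta eqxx mulr1.
Qed.

Lemma diagonal_coef_component A x (c : S) :
  diagonal_coef A x c = component A x (enum_rank c) (enum_rank c).
Proof. by rewrite mxE enum_rankK. Qed.

Lemma diagonal_of_component A : local_unitary A ->
  (forall x i j, i != j -> component A x i j = 0) ->
  exists u, (forall x c, `|u x c| = 1) /\ diagonal u A.
Proof.
move=> Al A0; exists (diagonal_coef A).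
have e : component A = diag_components (diagonal_coef A).
  apply/funext => x; apply/matrixP => i j; rewrite [RHS]mxE [X in X *+ _]mxE.
  have [<-|ij] := eqVneq i j; last by rewrite A0.
  by rewrite mulr1n diagonal_coef_component enum_valK.
split=> [x c|].
- have := component_unitary x Al; rewrite e => /diag_mx_unitary /(_ (enum_rank c)).
  by rewrite mxE enum_rankK.
- apply/diagonalP/decompositionP => psi x.
  by rewrite -e fiber_local.
Qed.

(** * The intertwining relation between the step, the coins and the symmetry operators *)

Definition trivial_coin : quantum_coin R S :=
  QuantumCoin (fun=> local_unitary_local_op (fun x : G => ug_one_subproof R n_)).

Lemma trivial_coinE n psi : trivial_coin n psi = psi.
Proof. by apply: l2_fiber_inj => x; rewrite fiber_local_op mul1mx. Qed.

(* Conjugated by the step, a diagonal U_(n+1) acts on the fiber over x by the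
   matrix V_(n,x). *)
Lemma step_coin_factor U n psi phi : symmetry_parameters U ->
  (step psi = U n.+1 (step phi)) <->
  forall x, fiber psi x = coin_factor U n x *m fiber phi x.
Proof.
move=> [_ /(_ n.+1 isT) [u [_ uU]]]; rewrite /coin_factor (diagonal_coefE uU).
split=> [e x|e].
- apply/colP => i; rewrite mul_diag_mx !mxE /=.
  (* The entry at [(x, c)] before the step sits at [(x * c, c)] after it; hence the shifted argument
     of [u] in [coin_factor]. *)
  have := congr1 (fun f : H => f (x * val (enum_val i), enum_val i)%g) e.
  by rewrite uU /= /step_fun /= !mulgK.
- apply/val_inj/funext => -[x c]; rewrite /= uU /= /step_fun /=.
  by rewrite fiberE e mul_diag_mx !mxE /= !enum_rankK mulgVK.
Qed.

(** Every vector has the form [U n phi], and the adjoint of the component of [U n] undoes [U n] on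
    each fiber; the rest is [step_coin_factor]. *)
Lemma coin_intertwining U n K K' : symmetry_parameters U ->
  (forall phi, step (K' n (U n phi)) = U n.+1 (step (K n phi))) <->
  decomposition (fun x => coin_factor U n x *m component (K n) x
                          *m adjoint (component (U n) x)) (K' n).
Proof.
move=> pU; have Ul := pU.1 n; rewrite decompositionP; split=> [e psi x|e phi].
- have [phi <-] := local_unitary_surj psi Ul.
  have /(step_coin_factor _ _ _ pU) -> := e phi.
  rewrite [fiber (U n phi) x]fiber_local// fiber_local; last exact: coin_opP.
  rewrite -!mulmxA (mulmxA (adjoint _)) unitarymx_adjoint ?component_unitary//.
  by rewrite mul1mx.
- apply/(step_coin_factor _ _ _ pU) => x.
  rewrite e fiber_local// [fiber (K n phi) x]fiber_local; last exact: coin_opP.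
  rewrite -!mulmxA (mulmxA (adjoint _)) unitarymx_adjoint ?component_unitary//.
  by rewrite mul1mx.
Qed.

Lemma coin_factor_unitary U n x : symmetry_parameters U ->
  coin_factor U n x \is unitarymx.
Proof.
move=> [_ /(_ n.+1 isT) [u [u1 uU]]]; rewrite /coin_factor (diagonal_coefE uU).
by apply/diag_mx_unitary => i; rewrite mxE.
Qed.

(** Take an initial state [psi'] that evolves to [phi] in [n] steps and compare times [n] and
    [n.+1]. The new coin ignores the initial state, so [psi'] may be exchanged for [psi]. *)
Lemma symmetry_intertwining (T : walk_map R S) U :
  (forall n, local_unitary (U n)) ->
  (forall K psi psi', (T (K, psi)).1 = (T (K, psi')).1) ->
  (forall K psi n,
     evolution (T (K, psi)).1 n (T (K, psi)).2 = U n (evolution K n psi)) ->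
  forall K psi n phi,
    step ((T (K, psi)).1 n (U n phi)) = U n.+1 (step (K n phi)).
Proof.
move=> Ul T1 TU K psi n phi; have [psi' <-] := evolution_surj K n phi.
by have := TU K psi' n.+1; rewrite /= TU (T1 K psi' psi).
Qed.

(* Applied to the trivial coin, the intertwining relation makes the conjugate
   of U_(n+1) by the step a local operator, so U_(n+1) cannot mix two coin
   states over the same vertex: the step sends them to different vertices. *)
Lemma symmetry_diagonal U n K : (forall n, local_unitary (U n)) ->
  (forall phi, step (K n (U n phi)) = U n.+1 (step phi)) ->
  exists u, (forall x c, `|u x c| = 1) /\ diagonal u (U n.+1).
Proof.
move=> Ul KU; apply: diagonal_of_component => // x i j ij.
set c := enum_val j; set d := enum_val i.
have cd : d != c by rewrite (inj_eq enum_val_inj).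
rewrite mxE -/c -/d.
have -> : ket R x c = step (ket R (x * (val c)^-1)%g c).
  by rewrite step_ket mulgVK.
rewrite -KU /= /step_fun /= fiberE fiber_local; last exact: coin_opP.
(* The entry at [(x, d)] is read off over [x * d^-1], while the basis vector lives over the
   different vertex [x * c^-1]. *)
rewrite fiber_local// fiber_basis_vector (_ : (_ == _) = false).
  by rewrite scale0r !mulmx0 mxE.
by rewrite (inj_eq (mulgI _)) (inj_eq invg_inj) (inj_eq val_inj) (negbTE cd).
Qed.

(** Trades the matrices for operator equations, which makes induction on time, uniqueness and
    composition a matter of rewriting. *)
Lemma symmetry_formulaP (T : walk_map R S) U : symmetry_parameters U ->
  symmetry_formula T U <->
  (forall K psi, (T (K, psi)).2 = U 0%N psi) /\
  (forall K psi n phi,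
     step ((T (K, psi)).1 n (U n phi)) = U n.+1 (step (K n phi))).
Proof.
move=> pU; split=> [[T2 _ TU]|[T2 TU]].
- by split=> // K psi n; apply/coin_intertwining.
- split=> [//|n x|K psi n]; first exact: coin_factor_unitary.
  by apply/coin_intertwining => //; exact: TU.
Qed.

(** * Correspondence between symmetries and their operators *)

Lemma symmetry_formula_exists (T : walk_map R S) : unitary_symmetry T ->
  exists U, symmetry_parameters U /\ symmetry_formula T U.
Proof.
move=> [T1 [U [Ul TU]]]; have TUi := symmetry_intertwining Ul T1 TU.
have pU : symmetry_parameters U.
  split=> // -[//|n] _.
  (* The state [0] is an arbitrary choice, as the new coin does not depend on it. *)
  apply: (symmetry_diagonal (K := (T (trivial_coin, 0)).1) Ul) => phi.
  by rewrite TUi trivial_coinE.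
exists U; split=> //; apply/symmetry_formulaP => //; split=> // K psi.
exact: (TU K psi 0%N).
Qed.

(** The formula fixes the new coin without reference to the state, and the evolution equation
    follows by induction on time, with one use of the intertwining relation per step. *)
Lemma symmetry_formula_symmetry (T : walk_map R S) U : symmetry_parameters U ->
  symmetry_formula T U -> unitary_symmetry T.
Proof.
move=> pU TU; have [T2 TUi] := (symmetry_formulaP T pU).1 TU; split.
- case: TU => _ _ TU K psi psi'; apply: quantum_coin_inj => n.
  by apply: decomposition_inj (TU _ _ _) (TU _ _ _).
- exists U; split=> [|K psi]; first by case: pU.
  by elim=> [|n IH] /=; [exact: T2|rewrite IH TUi].
Qed.

Lemma symmetry_formula_fun (T T' : walk_map R S) U :
  symmetry_formula T U -> symmetry_formula T' U -> T = T'.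
Proof.
move=> [T2 _ TU] [T2' _ TU']; apply/funext => -[K psi].
rewrite [LHS]surjective_pairing [RHS]surjective_pairing T2 T2'; congr pair.
apply: quantum_coin_inj => n.
exact: decomposition_inj (TU _ _ _) (TU' _ _ _).
Qed.

(** Recursion in time: [U 0] is the action on initial states, and for the trivial coin the
    intertwining relation expresses [U n.+1] through [U n] on the range of the step, which is
    everything. *)
Lemma symmetry_formula_inj (T : walk_map R S) U U' :
  symmetry_parameters U -> symmetry_parameters U' ->
  symmetry_formula T U -> symmetry_formula T U' -> U = U'.
Proof.
move=> pU pU' TU TU'; apply/funext; elim=> [|n IH].
  case: TU TU' => [T2 _ _] [T2' _ _]; apply/funext => psi.
  by rewrite -(T2 trivial_coin) T2'.
have [_ TUi] := (symmetry_formulaP T pU).1 TU.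
have [_ TUi'] := (symmetry_formulaP T pU').1 TU'.
apply/funext => psi; have [phi <-] := step_surj psi.
by rewrite -[phi](trivial_coinE n) -(TUi _ 0) -(TUi' _ 0) IH.
Qed.

(** The intertwining relations chain: that of [T] is used at the coin produced by [T'], then that of
    [T']. *)
Lemma symmetry_formula_comp (T T' : walk_map R S) U U' U'' :
  symmetry_parameters U -> symmetry_parameters U' -> symmetry_parameters U'' ->
  (forall n psi, U'' n psi = U n (U' n psi)) ->
  symmetry_formula T U -> symmetry_formula T' U' ->
  symmetry_formula (T \o T') U''.
Proof.
move=> pU pU' pU'' UU' /(symmetry_formulaP _ pU) [T2 TU].
move=> /(symmetry_formulaP _ pU') [T2' TU'].
apply/(symmetry_formulaP _ pU''); split=> [K psi|K psi n phi] /=.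
- by rewrite UU' [T' _]surjective_pairing T2 T2'.
- by rewrite !UU' [T' _]surjective_pairing TU TU'.
Qed.

(** * The symmetry built from given operators *)

Section walk_of.
Variable U : nat -> H -> H.
Hypothesis pU : symmetry_parameters U.

Lemma transformed_coin_subproof K n x :
  coin_factor U n x *m component (K n) x *m adjoint (component (U n) x)
    \is unitarymx.
Proof.
rewrite !mul_unitarymx ?coin_factor_unitary ?component_unitary//.
- exact: coin_opP.
- by rewrite trmxC_unitary component_unitary//; case: pU.
Qed.

Definition transformed_coin K : quantum_coin R S :=
  QuantumCoin (fun n => local_unitary_local_op (transformed_coin_subproof K n)).

Definition walk_of : walk_map R S := fun p => (transformed_coin p.1, U 0%N p.2).

Lemma walk_of_formula : symmetry_formula walk_of U.
Proof.
split=> [//|n x|K psi n]; first exact: coin_factor_unitary.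
apply/decompositionP => phi x.
exact: (fiber_local_op (transformed_coin_subproof K n)).
Qed.

End walk_of.

(** * Operators encoded by the parameter group *)

Section parameters.
Local Notation pgroup := (parameter_group R S).
Implicit Types k l : pgroup.

(** The index is shifted: these are the coefficients of the operator at time [n.+1], whose
    positivity holds by computation. *)
Definition phase k n (x : G) (c : S) : C := k.2 (x, exist _ n.+1 isT, c).

Lemma phase_norm k n x c : `|phase k n x c| = 1.
Proof. exact/eqP/circle_valP. Qed.

Definition operators k (n : nat) : H -> H :=
  if n is m.+1 then local_op (diag_components_unitary (phase_norm k m))
  else local_op (fun x => ugvalP (k.1 x)).

Lemma operators_diagonal k n : diagonal (phase k n) (operators k n.+1).
Proof. by apply/diagonalP/decompositionP => psi x; exact: fiber_local_op. Qed.

Lemma operators_parameters k : symmetry_parameters (operators k).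
Proof.
split=> [[|n]|[//|n] _]; try exact: local_unitary_local_op.
by exists (phase k n); split; [exact: phase_norm|exact: operators_diagonal].
Qed.

Lemma operators_values k : parameter_values k (operators k).
Proof.
split=> [|[[//|n] n0]].
  by apply/decompositionP => psi x; exact: fiber_local_op.
(* The positivity proof is irrelevant, so the index can be brought to the form used in [phase]. *)
rewrite (_ : exist _ _ _ = exist _ n.+1 isT :> positive_nat).
  exact: operators_diagonal.
exact: val_inj.
Qed.

Lemma parameter_values_fun k U U' :
  parameter_values k U -> parameter_values k U' -> U = U'.
Proof.
move=> [U0 U1] [U0' U1']; apply/funext => -[|n].
  exact: decomposition_inj U0 U0'.
have /diagonalP U1n := U1 (exist _ n.+1 isT).
have /diagonalP U1n' := U1' (exist _ n.+1 isT).
exact: decomposition_inj U1n U1n'.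
Qed.

Lemma parameter_values_inj k l U :
  parameter_values k U -> parameter_values l U -> k = l.
Proof.
case: k l => [k1 k2] [l1 l2] [/= k0 kn] [/= l0 ln]; congr pair.
- apply/funext => x; apply/val_inj.
  have e := componentE k0; rewrite (componentE l0) in e.
  by have := congr1 (fun f : G -> coin_mx => f x) e; rewrite /= => /esym.
- apply/funext => -[[x n] c]; apply/val_inj.
  have e := diagonal_coefE (kn n); rewrite (diagonal_coefE (ln n)) in e.
  by have := congr1 (fun f : G -> S -> C => f x c) e; rewrite /= => /esym.
Qed.

Lemma parameter_values_exists U : symmetry_parameters U ->
  exists k, parameter_values k U.
Proof.
move=> [Ul Ud].
have d1 (n : positive_nat) x c : `|diagonal_coef (U (val n)) x c| == 1.
  by have [u [u1 uU]] := Ud _ (valP n); rewrite (diagonal_coefE uU) u1.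
exists (fun x => UnitaryGroup (component_unitary x (Ul 0%N)),
        fun p => Circle (d1 p.1.2 p.1.1 p.2)).
split=> [|n] /=; first by apply/decompositionP => psi x; exact: fiber_local.
by have [u [_ uU]] := Ud _ (valP n); rewrite (diagonal_coefE uU).
Qed.

Lemma operatorsM k l n psi :
  operators (k * l)%g n psi = operators k n (operators l n psi).
Proof.
case: n => [|n].
  by apply: l2_fiber_inj => x; rewrite !fiber_local_op mulmxA.
apply/val_inj/funext => -[x c].
have d k' phi := operators_diagonal k' n phi x c.
by rewrite [LHS]d [RHS]d d mulrA.
Qed.

End parameters.

End quantum_walks.

(** * The isomorphism from the parameter group to the symmetries *)

Theorem theorem1 (R : realType) (G : groupType) (S : {fset G})
    (genS : generates S) :
  [/\ forall T : walk_map R S, unitary_symmetry T ->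
        exists! U, symmetry_parameters U /\ symmetry_formula T U,
      forall U : nat -> l2 R (G * S)%type -> l2 R (G * S)%type,
        symmetry_parameters U ->
        exists! T : walk_map R S, unitary_symmetry T /\ symmetry_formula T U &
      transformation_group (@unitary_symmetry R G S) /\
      exists Phi : parameter_group R S -> walk_map R S,
        [/\ set_bij setT (@unitary_symmetry R G S) Phi,
            forall k l, Phi (k * l)%g = Phi k \o Phi l &
            forall k, exists U, [/\ symmetry_parameters U,
              parameter_values k U & symmetry_formula (Phi k) U]]].
Proof.
pose Phi k := walk_of (operators_parameters k) : walk_map R S.
have PhiF k : symmetry_formula (Phi k) (operators k) by exact: walk_of_formula.
have PhiS k : unitary_symmetry (Phi k).
  exact: symmetry_formula_symmetry (operators_parameters k) (PhiF k).
have Phi_inj k l : Phi k = Phi l -> k = l.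
  move=> kl; apply: (parameter_values_inj (operators_values k)).
  have lF := PhiF l; rewrite -kl in lF.
  rewrite (symmetry_formula_inj (operators_parameters k)
    (operators_parameters l) (PhiF k) lF).
  exact: operators_values.
have Phi_surj T : unitary_symmetry T -> exists k, Phi k = T.
  move=> /symmetry_formula_exists[U [pU TU]].
  have [k kU] := parameter_values_exists pU; exists k.
  apply: (symmetry_formula_fun (PhiF k)).
  by rewrite (parameter_values_fun (operators_values k) kU).
(* Both sides satisfy the formula for [operators (k * l)], which determines the map. *)
have PhiM k l : Phi (k * l)%g = Phi k \o Phi l.
  apply: (symmetry_formula_fun (PhiF (k * l)%g)).
  exact: (symmetry_formula_comp (operators_parameters k)
    (operators_parameters l) (operators_parameters (k * l)%g)
    (operatorsM k l) (PhiF k) (PhiF l)).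
split.
- move=> T /symmetry_formula_exists[U [pU TU]]; exists U; split=> // U' [pU' TU'].
  exact: symmetry_formula_inj pU pU' TU TU'.
- move=> U pU; exists (walk_of pU).
  have F := walk_of_formula pU.
  split=> [|T [_ TU]]; last exact: symmetry_formula_fun F TU.
  by split=> //; exact: symmetry_formula_symmetry F.
(* Every operator is [id] here; its local unitarity is borrowed from the trivial coin. *)
- have idS : unitary_symmetry (id : walk_map R S).
    split=> //; exists (fun=> id); split=> // n.
    have := coin_opP (trivial_coin R S) n.
    rewrite (_ : trivial_coin R S n = id)//.
    by apply/funext => psi; exact: trivial_coinE.
  (* By surjectivity [id] is some [Phi k]; since [id] is idempotent and [Phi] injective,
     [k * k = k], which forces [k] to be the unit. *)
  have Phi1 : Phi 1%g = id.
    have [k kid] := Phi_surj _ idS; rewrite -kid; congr Phi.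
    have : Phi (k * k)%g = Phi k by rewrite PhiM kid.
    by move=> /Phi_inj kk; apply: (mulgI k); rewrite kk mulg1.
  split; last first.
    exists Phi; split=> //.
    + split=> [k _|k l _ _|T /Phi_surj[k <-]]; last by exists k.
      * exact: PhiS.
      * exact: Phi_inj.
    + move=> k; exists (operators k); split=> //; first exact: operators_parameters.
      exact: operators_values.
  split=> // [T T' /Phi_surj[k <-] /Phi_surj[l <-]|T /Phi_surj[k <-]].
    by rewrite -PhiM.
  exists (Phi k^-1%g); split=> //.
  + move=> p; have := congr1 (@^~ p) (PhiM k^-1%g k).
    by rewrite mulVg Phi1 /= => <-.
  + move=> p; have := congr1 (@^~ p) (PhiM k k^-1%g).
    by rewrite mulgV Phi1 /= => <-.
Qed.
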